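(* Let $n \ge 3$, let $C_n$ be a cycle on $n$ vertices, let $R$ be a simple $2$-regular graph on $n$ vertices (a disjoint union of cycles) vertex-disjoint from $C_n$, and let $\phi : V(C_n) \to V(R)$ be a bijection. Let $G$ be the graph with vertex set $V(C_n) \cup V(R)$ and edge set $E(C_n) \cup E(R) \cup \{v\phi(v) : v \in V(C_n)\}$ (a ring permutation graph). Then $\chi'_{\mathrm{irr}}(G) \le 3$, i.e., $G$ admits a locally irregular edge-coloring using at most $3$ colors. In particular this holds for every cycle permutation graph (the case where $R$ is a single $n$-cycle) and for every generalized Petersen graph $P(n,k)$ (vertices $u_0,\dots,u_{n-1},v_0,\dots,v_{n-1}$, edges $u_iu_{i+1}, u_iv_i, v_iv_{i+k}$, indices mod $n$, $k<n/2$).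
   Context: A graph is locally irregular if no two adjacent vertices have the same degree. A locally irregular edge-coloring of a graph is an (not necessarily proper) edge-coloring such that the edges of each color induce a locally irregular graph; equivalently, for every edge $uv$ of color $i$, the numbers of edges of color $i$ at $u$ and at $v$ differ. $\chi'_{\mathrm{irr}}(G)$ denotes the minimum number of colors in such a coloring of $G$ (when one exists). *)

(* Defs.v *)
From mathcomp Require Import all_boot.

Set Implicit Arguments.
Unset Strict Implicit.
Unset Printing Implicit Defensive.

Record sgraph := SGraph {
  vertex :> finType;
  adj : rel vertex;
  adj_sym : symmetric adj;
  adj_irrefl : irreflexive adj
}.

Definition graph_iso (G H : sgraph) : Prop :=
  exists f : G -> H,
    bijective f /\ forall x y : G, adj (f x) (f y) = adj x y.

Definition degree (G : sgraph) (x : G) : nat := #|[set y | adj x y]|.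

Definition regular (G : sgraph) (d : nat) : Prop := forall x : G, degree x = d.

Definition locally_irregular (G : sgraph) : bool :=
  [forall x : G, forall y : G, adj x y ==> (degree x != degree y)].

Definition edges (G : sgraph) : {set {set G}} :=
  [set e : {set G} | [exists x, exists y, adj x y && (e == [set x; y])]].

Definition edge (G : sgraph) := {e : {set G} | e \in edges G}.

Section ColorClass.
Variables (G : sgraph) (k : nat) (c : {ffun edge G -> 'I_k}) (i : 'I_k).

Definition class_adj : rel G :=
  fun x y => [exists e : edge G, (val e == [set x; y]) && (c e == i)].

Fact class_adj_sym : symmetric class_adj.
Proof. by move=> x y; apply: eq_existsb => e; rewrite setUC. Qed.

Fact class_adj_irrefl : irreflexive class_adj.
Proof.
move=> x; apply/existsP => -[[e eG] /= /andP[/eqP ex _]]; subst e.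
have := eG; rewrite inE => /existsP[u /existsP[v /andP[uv /eqP xuv]]].
have uvE : u = v.
  have : u \in [set x; x] by rewrite xuv set21.
  have : v \in [set x; x] by rewrite xuv set22.
  by rewrite setUid !inE => /eqP-> /eqP->.
by rewrite uvE adj_irrefl in uv.
Qed.

(* The spanning subgraph of the edges of color i. The vertices not incident to
   such an edge are isolated in it, hence have no effect on local
   irregularity. *)
Definition color_class : sgraph := SGraph class_adj_sym class_adj_irrefl.

End ColorClass.

Definition locally_irregular_coloring (G : sgraph) (k : nat)
    (c : {ffun edge G -> 'I_k}) : bool :=
  [forall i : 'I_k, locally_irregular (color_class c i)].

Definition irr_colorable (G : sgraph) (k : nat) : bool :=
  [exists c : {ffun edge G -> 'I_k}, locally_irregular_coloring c].

Definition irr_decomposable (G : sgraph) : Prop := exists k, irr_colorable G k.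

Definition chi_irr (G : sgraph) (dG : irr_decomposable G) : nat := ex_minn dG.

(* The conjunct i != j excludes loops; it is redundant unless n divides k. *)
Definition circ_adj (n k : nat) : rel 'I_n :=
  fun i j => (i != j) && ((j == (i + k) %% n :> nat) || (i == (j + k) %% n :> nat)).

Fact circ_adj_sym n k : symmetric (@circ_adj n k).
Proof. by move=> i j; rewrite /circ_adj eq_sym orbC. Qed.

Fact circ_adj_irrefl n k : irreflexive (@circ_adj n k).
Proof. by move=> i; rewrite /circ_adj eqxx. Qed.

Definition cycle_graph (n : nat) : sgraph :=
  SGraph (@circ_adj_sym n 1) (@circ_adj_irrefl n 1).

Section PermutationGraph.
Variables (C R : sgraph) (phi : C -> R).

Definition perm_adj : rel (C + R)%type :=
  fun x y => match x, y with
  | inl u, inl v => adj u v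
  | inr u, inr v => adj u v
  | inl u, inr v => v == phi u
  | inr u, inl v => u == phi v
  end.

Fact perm_adj_sym : symmetric perm_adj.
Proof. by move=> [u|u] [v|v] //=; apply: adj_sym. Qed.

Fact perm_adj_irrefl : irreflexive perm_adj.
Proof. by move=> [u|u] /=; apply: adj_irrefl. Qed.

Definition perm_graph : sgraph := SGraph perm_adj_sym perm_adj_irrefl.

End PermutationGraph.

Section GeneralizedPetersen.
Variables (n k : nat).

(* inl i is the vertex u_i and inr i is the vertex v_i. *)
Definition petersen_adj : rel ('I_n + 'I_n)%type :=
  fun x y => match x, y with
  | inl i, inl j => circ_adj 1 i j
  | inr i, inr j => circ_adj k i j
  | inl i, inr j => i == j
  | inr i, inl j => i == j
  end.

Fact petersen_adj_sym : symmetric petersen_adj.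
Proof. by move=> [i|i] [j|j] /=; (apply: circ_adj_sym || apply: eq_sym). Qed.

Fact petersen_adj_irrefl : irreflexive petersen_adj.
Proof. by move=> [i|i] /=; apply: circ_adj_irrefl. Qed.

Definition generalized_petersen : sgraph :=
  SGraph petersen_adj_sym petersen_adj_irrefl.

End GeneralizedPetersen.

(* Main.v *)
Require Import Defs.
From mathcomp Require Import all_boot zify.

Set Implicit Arguments.
Unset Strict Implicit.
Unset Printing Implicit Defensive.

(**
  Orient the cycle by s and the 2-regular graph R by p. Every edge of R gets the
  base color, except that on an odd cycle of R one arc is removed from the base
  class, so that neighbors on R have distinct base degrees. The edges of the
  cycle get one of the two colors true and false. Labels on R say which
  matching edges are in the base class; a coloring of the cycle and of the other
  matching edges is then a closed walk, read along the cycle, of a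
  nondeterministic automaton whose states record the color of an arc u -> s u and
  the degree of u in that color. Up to detours the automaton adds the weight of
  the label to a counter modulo 4. If some cycle of R has length at least 4, the
  labeling can be chosen with a short label next to one that is not long, and
  this gives enough freedom to close the walk. If R is a union of triangles, the
  total weight is 0 or 2 modulo 4; in the latter case a long, bare, long pattern
  contributes the missing 2, except for the prism, colored by hand.
*)

(** * Colorings as functions on pairs of vertices *)

Section ColoringFunctions.
Variable K : finType.

Definition col_deg (G : sgraph) (col : G -> G -> K) (x : G) (i : K) : nat :=
  #|[set z | adj x z && (col x z == i)]|.

Definition irr_col (G : sgraph) (col : G -> G -> K) : Prop :=
  forall x y : G, adj x y ->
    col x y = col y x /\ col_deg col x (col x y) != col_deg col y (col x y).

(** Each edge takes the color of one chosen ordered pair of its ends; symmetry of [col] on adjacent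
    pairs makes the choice immaterial. *)
Lemma irr_colorable_col (G : sgraph) (col : G -> G -> K) :
  irr_col col -> irr_colorable G #|K|.
Proof.
move=> colP.
have edgeP (e : edge G) : {p : G * G | adj p.1 p.2 & val e = [set p.1; p.2]}.
  case: (pickP (fun p : G * G => adj p.1 p.2 && (val e == [set p.1; p.2]))).
    by move=> p /andP[? /eqP]; exists p.
  have := valP e; rewrite inE => /existsP ex abs; exfalso.
  by case: ex => x /existsP[y xy]; have := abs (x, y); rewrite /= xy.
pose c : {ffun edge G -> 'I_#|K|} :=
  [ffun e => enum_rank (col (s2val (edgeP e)).1 (s2val (edgeP e)).2)].
have cE (e : edge G) x y : adj x y -> val e = [set x; y] ->
    c e = enum_rank (col x y).
  move=> xy eE; rewrite ffunE; case: (edgeP e) => [[u v] /= uv]; rewrite eE => exy.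
  have [] : (u = x /\ v = y) \/ (u = y /\ v = x).
  - have : x \in [set u; v] by rewrite -exy set21.
    have : y \in [set u; v] by rewrite -exy set22.
    have xNy : x != y by apply: contraTneq xy => ->; rewrite adj_irrefl.
    rewrite !inE => /orP[]/eqP yE /orP[]/eqP xE; subst; auto;
      by rewrite eqxx in xNy.
  - by case=> -> ->.
  - by case=> -> ->; rewrite (colP _ _ xy).1.
have adjE i x y : class_adj c i x y = adj x y && (enum_rank (col x y) == i).
  apply/existsP/andP => [[e /andP[/eqP eE /eqP ci]]|[xy /eqP ci]].
    have xy : adj x y.
      have := valP e; rewrite inE => /existsP[u /existsP[v /andP[uv /eqP]]].
      rewrite eE => exy.
      have : x \in [set u; v] by rewrite -exy set21.
      have : y \in [set u; v] by rewrite -exy set22.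
      have : u \in [set x; y] by rewrite exy set21.
      have : v \in [set x; y] by rewrite exy set22.
      have uNv : u != v by apply: contraTneq uv => ->; rewrite adj_irrefl.
      rewrite !inE => /orP[]/eqP vE /orP[]/eqP uE; subst => //.
      - by rewrite eqxx in uNv.
      - by rewrite adj_sym.
      - by rewrite eqxx in uNv.
    by rewrite xy -ci (cE e x y).
  have eG : [set x; y] \in edges G.
    by rewrite inE; apply/existsP; exists x; apply/existsP; exists y; rewrite xy eqxx.
  by exists (exist (fun e => e \in edges G) _ eG); rewrite /= eqxx (cE _ x y) //= ci.
apply/existsP; exists c; apply/forallP => i; apply/forallP => x.
apply/forallP => y; apply/implyP; rewrite /= adjE => /andP[xy /eqP ci].
have degE z : degree (z : color_class c i) = col_deg col z (col x y).
  by rewrite /degree /col_deg; apply: eq_card => t; rewrite !inE /= adjE -ci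
    (inj_eq enum_rank_inj).
by rewrite !degE; case: (colP _ _ xy).
Qed.

Lemma irr_col_iso (G H : sgraph) (f : G -> H) (col : H -> H -> K) :
  bijective f -> (forall x y, adj (f x) (f y) = adj x y) ->
  irr_col col -> irr_col (fun x y => col (f x) (f y)).
Proof.
move=> fbij fadj colP x y; rewrite -fadj => xy.
have degE z i : col_deg (fun x y => col (f x) (f y)) z i = col_deg col (f z) i.
  rewrite /col_deg -(on_card_preimset (f := f)); last exact: onW_bij.
  by apply: eq_card => t; rewrite !inE fadj.
by rewrite !degE; exact: colP.
Qed.

Lemma col_deg_nbrs (G : sgraph) (col : G -> G -> K) x (s : seq G) i :
  uniq s -> (forall z, adj x z = (z \in s)) ->
  col_deg col x i = \sum_(z <- s) (col x z == i).
Proof.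
move=> us sE; rewrite /col_deg cardsE -sum1_card big_mkcondr /=.
rewrite (big_uniq _ us) /=.
by apply: eq_big => [z|z _]; [exact: sE|case: (_ == _)].
Qed.

End ColoringFunctions.

Lemma chi_irr_leq (G : sgraph) k :
  irr_colorable G k -> exists dG : irr_decomposable G, chi_irr dG <= k.
Proof. by move=> Gk; exists (ex_intro _ k Gk); rewrite /chi_irr; case: ex_minnP => m _; apply. Qed.

(** * Orientation of the cycles of a 2-regular graph *)

Definition orients (G : sgraph) (s t : G -> G) : Prop :=
  [/\ cancel s t, cancel t s, forall x, s (s x) != x
    & forall x y, adj x y = (y == s x) || (y == t x)].

Section Orientation.
Variable (R : sgraph).
Hypothesis R2 : regular R 2.

Definition other_nbr (y x : R) : R := odflt x [pick z | adj y z && (z != x)].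

Lemma other_nbrP (y x : R) : adj y x ->
  [/\ adj y (other_nbr y x), other_nbr y x != x &
      forall z, adj y z -> z = x \/ z = other_nbr y x].
Proof.
move=> yx; have := R2 y; rewrite /degree => deg2.
have xy : x \in [set z | adj y z] by rewrite inE.
have := deg2; rewrite (cardsD1 x) xy => -[] /eqP/cards1P[z zE].
have nE t : adj y t && (t != x) = (t == z).
  by move/setP: zE => /(_ t); rewrite !inE andbC.
rewrite /other_nbr; case: pickP => [t|abs]; last first.
  by have := nE z; rewrite abs eqxx.
rewrite nE /= => /eqP->; have /andP[yz zx] : adj y z && (z != x) by rewrite nE.
split=> // u yu; have [->|ux] := eqVneq u x; first by left.
by right; apply/eqP; rewrite -nE yu.
Qed.

(* The orbits of [dart_next] are the oriented cycles of R. Reversing a dart changes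
   the orbit, so comparing canonical representatives of both orbits selects one
   orientation of each cycle. *)
Definition dart_next (e : R * R) : R * R :=
  if adj e.1 e.2 then (e.2, other_nbr e.2 e.1) else e.

(** Reversal conjugates [dart_next] to its inverse; injectivity follows. *)
Lemma dart_next_rev e :
  dart_next (swap_pair (dart_next e)) = swap_pair e.
Proof.
case: e => x y; rewrite /dart_next /=; case xy: (adj x y) => /=; last first.
  by rewrite adj_sym xy.
have yx : adj y x by rewrite adj_sym.
have [yz zx _] := other_nbrP yx.
rewrite adj_sym yz; congr pair.
have [_ /eqP tz nbr] := other_nbrP yz.
by have [//|] := nbr x yx => E; rewrite -E.
Qed.

Lemma dart_next_inj : injective dart_next.
Proof.
move=> e e' E; have := dart_next_rev e; rewrite E dart_next_rev.
by case: e {E} => ? ?; case: e' => ? ? [-> ->].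
Qed.

(** Descent by two: if [k.+2] steps reverse a dart, then [k] steps reverse the next dart, since one
    step can be cancelled at each end. The cases 0 and 1 would give a loop and an immediate turn
    back. *)
Lemma dart_orbit_rev k x y : adj x y -> iter k dart_next (x, y) <> (y, x).
Proof.
have [m] := ubnP k; elim: m k x y => // m IHm [|[|k]] x y km xy.
- by move=> /= [E _]; rewrite E adj_irrefl in xy.
- rewrite /= /dart_next /= xy => -[E].
  by have yx : adj y x by [rewrite adj_sym]; have [_ /eqP] := other_nbrP yx.
have yx : adj y x by rewrite adj_sym.
have [yz _ _] := other_nbrP yx.
have nE : dart_next (x, y) = (y, other_nbr y x) by rewrite /dart_next /= xy.
rewrite iterS iterSr nE => E.
apply: (IHm k _ _ _ yz); first lia.
apply: dart_next_inj; rewrite E.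
by have := dart_next_rev (x, y); rewrite nE.
Qed.

Definition dart_rank (e : R * R) : nat := enum_rank (froot dart_next e).

Lemma dart_rank_rev x y : adj x y -> dart_rank (x, y) != dart_rank (y, x).
Proof.
move=> xy; apply/eqP => /ord_inj/enum_rank_inj/eqP.
rewrite root_connect; last exact: fconnect_sym dart_next_inj.
by move/iter_findex => /(dart_orbit_rev xy).
Qed.

Lemma dart_rank_next x y :
  adj x y -> dart_rank (y, other_nbr y x) = dart_rank (x, y).
Proof.
move=> xy; rewrite /dart_rank; congr (nat_of_ord (enum_rank _)); apply/eqP.
rewrite eq_sym root_connect; last exact: fconnect_sym dart_next_inj.
by have := fconnect1 dart_next (x, y); rewrite /dart_next /= xy.
Qed.

Lemma dart_rank_prev x y :
  adj x y -> dart_rank (other_nbr x y, x) = dart_rank (x, y).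
Proof.
move=> xy; have [xz zy nbr] := other_nbrP xy.
have zx : adj (other_nbr x y) x by rewrite adj_sym.
rewrite -(dart_rank_next zx).
have [_ tz _] := other_nbrP xz; have [xt _ _] := other_nbrP xz.
by have [->//|E] := nbr _ xt; rewrite E eqxx in tz.
Qed.

Definition outdart (x y : R) : bool :=
  adj x y && (dart_rank (x, y) < dart_rank (y, x)).

(** The dart from [y] to [x] continues to [other_nbr x y], and the reversed darts also follow each
    other, so both ranks are kept in passing through [x]. *)
Lemma outdart_other x y :
  adj x y -> outdart x (other_nbr x y) = outdart y x.
Proof.
move=> xy; have yx : adj y x by rewrite adj_sym.
have [xz _ _] := other_nbrP xy.
by rewrite /outdart xz yx (dart_rank_next yx) (dart_rank_prev xy).
Qed.

Lemma outdart_otherV x y :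
  adj x y -> outdart (other_nbr x y) x = outdart x y.
Proof.
move=> xy; have yx : adj y x by rewrite adj_sym.
have [xz _ _] := other_nbrP xy.
by rewrite /outdart adj_sym xz xy (dart_rank_next yx) (dart_rank_prev xy).
Qed.

Lemma outdartC x y : adj x y -> outdart y x = ~~ outdart x y.
Proof.
move=> xy; rewrite /outdart adj_sym xy /=.
by have := dart_rank_rev xy; lia.
Qed.

Lemma outdart_inj x y z : outdart x y -> outdart x z -> y = z.
Proof.
move=> xy xz; have /andP[axy _] := xy; have /andP[axz _] := xz.
have [_ _ /(_ z axz)[->//|zE]] := other_nbrP axy.
by move: xz; rewrite zE outdart_other // outdartC // xy.
Qed.

Lemma outdart_injV x y z : outdart y x -> outdart z x -> y = z.
Proof.
move=> xy xz; have /andP[axy _] := xy; have /andP[axz _] := xz.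
move: axy axz; rewrite ![adj _ x]adj_sym => axy axz.
have [_ _ /(_ z axz)[->//|zE]] := other_nbrP axy.
by move: xz; rewrite zE outdart_otherV // -[outdart x y]negbK -outdartC // xy.
Qed.

Lemma exists_nbr x : exists y : R, adj x y.
Proof.
have : 0 < #|[set y | adj x y]| by have := R2 x; rewrite /degree => ->.
by case/card_gt0P=> y; rewrite inE; exists y.
Qed.

Lemma exists_outdart x : exists y, outdart x y.
Proof.
have [y xy] := exists_nbr x; case E: (outdart x y); first by exists y.
by exists (other_nbr x y); rewrite outdart_other // outdartC // E.
Qed.

Lemma exists_indart x : exists y, outdart y x.
Proof.
have [y xy] := exists_nbr x; case E: (outdart x y).
  by exists (other_nbr x y); rewrite outdart_otherV.
by exists y; rewrite outdartC // E.
Qed.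

Lemma regular2_orients : exists s t : R -> R, orients s t.
Proof.
pose s x := xchoose (exists_outdart x); pose t x := xchoose (exists_indart x).
have sP x : outdart x (s x) by apply: xchooseP.
have tP x : outdart (t x) x by exact: (xchooseP (exists_indart x)).
exists s, t; split.
- by move=> x; apply: (outdart_injV (tP _)).
- by move=> x; apply: (outdart_inj (sP _)).
- move=> x; apply/eqP => E; have := sP (s x); rewrite E outdartC ?sP //.
  by case/andP: (sP x).
- move=> x y; apply/idP/orP => [xy|[]/eqP->].
  + case E: (outdart x y); first by left; apply/eqP/(outdart_inj E (sP x)).
    by right; apply/eqP/(@outdart_injV x); rewrite ?tP // outdartC // E.
  + by case/andP: (sP x).
  + by rewrite adj_sym; case/andP: (tP x).
Qed.

End Orientation.

(** * The automaton of labels and states *)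

(* Bare: the matching edge at the vertex r of R has the base color. Short: it is
   colored by a boolean. Long: the arc from r to its successor has this boolean
   color too. *)
Variant label := Bare | Short | Long.

Definition is_bare l := if l is Bare then true else false.
Definition is_short l := if l is Short then true else false.
Definition is_long l := if l is Long then true else false.

Definition state := (bool * nat)%type.

(* The degree in color z of a vertex of the cycle whose cycle edges have colors
   x and y and whose matching edge has color m (the base color for Bare). *)
Definition vdeg (l : label) (m x y z : bool) : nat :=
  (x == z) + (y == z) + (~~ is_bare l && (m == z)).

(* The end in R of the matching edge has degree 1 (Short) or 2 (Long) in the color
   of that edge. *)
Definition match_ok (l : label) (d : nat) : bool :=
  match l with Bare => true | Short => d != 1 | Long => d != 2 end.

(** At a cycle vertex with label [l] and matching color [m], [s] is the state of its predecessor and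
    [t] its own. The conditions are: irregularity of the incoming cycle edge, correctness of the
    degree stored in [t], and irregularity of the matching edge. *)
Definition trans_with (l : label) (m : bool) (s t : state) : bool :=
  [&& s.2 != vdeg l m s.1 t.1 s.1, t.2 == vdeg l m s.1 t.1 t.1
    & match_ok l (vdeg l m s.1 t.1 m)].

Definition trans (l : label) (s t : state) : bool :=
  trans_with l true s t || trans_with l false s t.

(* [low] runs through the four states of degree at most 2, in the order in which
   Bare moves along them. *)
Definition low (k : nat) : state := (odd (k %/ 2), (odd k).+1).
Definition top (k : nat) : state := (odd (k %/ 2), 3).

Definition weight (l : label) : nat :=
  match l with Bare => 1 | Short => 2 | Long => 0 end.

Variant tail := NoLong | OddLong | EvenLong.

Definition next_tail (j : tail) (l : label) : tail :=
  if l is Long then (if j is OddLong then EvenLong else OddLong) else NoLong.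

(* States that a word of weight k, ending in a run of long labels described by j,
   certainly reaches from [low 0]. *)
Definition reachable (j : tail) (k : nat) : seq state :=
  match j with
  | NoLong => [:: low (k %% 4)]
  | OddLong => if odd k then [:: top (k %% 4)] else [:: low (k %% 4).+1; top (k %% 4)]
  | EvenLong => if odd k then [:: low (k %% 4)] else [:: low (k %% 4).+1; top (k %% 4)]
  end.

Lemma reachable_mod j k : reachable j (k %% 4) = reachable j k.
Proof. by rewrite /reachable modn_mod; case: j => //; rewrite (_ : odd (k %% 4) = odd k) //; lia. Qed.

(** Only [k] modulo 4 matters, so this is a finite check: each state listed after the letter has a
    predecessor listed before it. *)
Lemma reachable_next l j k : 
  all (fun t => has (fun s => trans l s t) (reachable j k))
      (reachable (next_tail j l) (k + weight l)).
Proof.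
rewrite -(reachable_mod j k) -(reachable_mod _ (k + _)) -modnDml.
have : k %% 4 < 4 by rewrite ltn_mod.
by move: (k %% 4) => [|[|[|[|//]]]] _; case: j; case: l; vm_compute.
Qed.

(** The intermediate state [t] may lie off the counter, so [Short] and [l] together are not bound to
    advance it by their weights. With the start [low k] free as well, every preceding weight [d] can
    be compensated. *)
Lemma reachable_close j d l : ~~ is_long l ->
  exists k, exists2 s, s \in reachable j (k + d) &
    exists2 t, trans Short s t & trans l t (low k).
Proof.
(* The intermediate state is sought among both colors and the degrees 1, 2, 3, and [k] among the
   residues modulo 4, which leaves a computation. *)
have states : 
  has (fun k => has (fun s => has (fun t => trans Short s t && trans l t (low k))
         [seq (c, e) | c <- [:: true; false], e <- [:: 1; 2; 3]])
     (reachable j (k + d))) (iota 0 4) ->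
  exists k, exists2 s, s \in reachable j (k + d) &
    exists2 t, trans Short s t & trans l t (low k).
  by case/hasP=> k _ /hasP[s ss /hasP[t _ /andP[? ?]]]; exists k, s => //; exists t.
move=> lN; apply: states; move: lN.
under eq_has => k do rewrite -(reachable_mod j (k + d)) -modnDmr.
have : d %% 4 < 4 by rewrite ltn_mod.
by move: (d %% 4) => [|[|[|[|//]]]] _; case: j; case: l => // _; vm_compute.
Qed.

Definition walk (w : nat -> label) (n : nat) (s t : state) : Prop :=
  exists q : nat -> state,
    [/\ q 0 = s, q n = t & forall i, i < n -> trans (w i) (q i) (q i.+1)].

Lemma walk0 w s : walk w 0 s s.
Proof. by exists (fun=> s). Qed.

Lemma walk_rcons w n s t u : walk w n s t -> trans (w n) t u -> walk w n.+1 s u.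
Proof.
case=> q [q0 qn qP] tu; exists (fun i => if i <= n then q i else u).
split; rewrite ?leq0n ?ltnn // => i; rewrite ltnS leq_eqVlt => /predU1P[->|lti].
  by rewrite eqxx ltnn qn.
by rewrite lti orbT qP.
Qed.

Definition total_weight (w : nat -> label) (a m : nat) : nat :=
  \sum_(a <= i < m) weight (w i).

Definition tail_type (w : nat -> label) (a m : nat) : tail :=
  foldl next_tail NoLong [seq w i | i <- index_iota a m].

Lemma index_iota_rcons a m : a <= m -> index_iota a m.+1 = rcons (index_iota a m) m.
Proof. by move=> am; rewrite /index_iota subSn // -addn1 iotaD cats1 subnKC. Qed.

Lemma tail_type_recr w a m : a <= m ->
  tail_type w a m.+1 = next_tail (tail_type w a m) (w m).
Proof. by move=> am; rewrite /tail_type index_iota_rcons // map_rcons foldl_rcons. Qed.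

Lemma low_mod k : low (k %% 4) = low k.
Proof. by rewrite /low; congr pair; [lia|congr S; lia]. Qed.

(** The walk is built backwards from [t]: [reachable_next] supplies a listed predecessor at each
    step, down to [low k] at position [a]. *)
Lemma walk_reachable w a m k s t : a <= m ->
  walk w a s (low k) ->
  t \in reachable (tail_type w a m) (k + total_weight w a m) -> walk w m s t.
Proof.
move=> am ws; elim: m am t => [|m IHm].
  rewrite leqn0 => /eqP a0 t; move: ws; rewrite a0.
  by rewrite /tail_type /total_weight big_geq //= addn0 inE low_mod => ws /eqP->.
rewrite leq_eqVlt => /predU1P[<- t|]; last rewrite ltnS => am t.
  by rewrite /tail_type /total_weight big_geq // /index_iota subnn /= addn0 inE low_mod => /eqP->.
rewrite tail_type_recr // /total_weight big_nat_recr //= addnA => tR.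
have /allP/(_ _ tR)/hasP[u uR tru] := reachable_next (w m) (tail_type w a m) (k + total_weight w a m).
exact: walk_rcons (IHm am u uR) tru.
Qed.

Lemma walk_low w a m k s : a <= m -> ~~ is_long (w m) -> walk w a s (low k) ->
  walk w m.+1 s (low (k + total_weight w a m.+1)).
Proof.
move=> am wm ws; apply: (walk_reachable _ ws); first exact: leqW.
rewrite tail_type_recr //; case: (w m) wm => // _; by rewrite inE low_mod.
Qed.

Definition closed_walk w n : Prop := exists s, walk w n s s.

Lemma closed_walk_short w m :
  is_short (w m) -> ~~ is_long (w m.+1) -> closed_walk w m.+2.
Proof.
move=> wm wm1.
have [k [s sR [t st tk]]] := reachable_close (tail_type w 0 m) (total_weight w 0 m) wm1.
exists (low k); apply: walk_rcons tk; apply: (@walk_rcons _ _ _ s).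
  by apply: walk_reachable sR => //; apply: walk0.
by case: (w m) wm st.
Qed.

Lemma closed_walk_weight0 w m :
  ~~ is_long (w m) -> 4 %| total_weight w 0 m.+1 -> closed_walk w m.+1.
Proof.
move=> wm /eqP w0; exists (low 0).
by have := walk_low (leq0n m) wm (walk0 w (low 0)); rewrite -[X in walk _ _ _ X]low_mod add0n w0.
Qed.

Lemma closed_walk_weight2 w m : 3 <= m ->
  is_long (w 0) -> is_bare (w 1) -> is_long (w 2) -> ~~ is_long (w m) ->
  total_weight w 0 m.+1 %% 4 = 2 -> closed_walk w m.+1.
Proof.
move=> m3 w0 w1 w2 wm W; exists (low 0).
(* [Long] can move from [low 0] to [low 1] and from [low 2] to [low 3], so these three letters
   advance the counter by 3, although their weight is 1. The surplus 2 cancels the residue 2. *)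
have ws : walk w 3 (low 0) (low 3).
  apply: (@walk_rcons _ _ _ (low 2)); last by case: (w 2) w2.
  apply: (@walk_rcons _ _ _ (low 1)); last by case: (w 1) w1.
  by apply: (@walk_rcons _ _ _ (low 0)); [exact: walk0|case: (w 0) w0].
have := walk_low m3 wm ws; rewrite -[X in walk _ _ _ X]low_mod.
move: W; rewrite /total_weight 3?[in X in X -> _]big_ltn ?leqW //; try lia.
case: (w 0) w0 => // _; case: (w 1) w1 => // _; case: (w 2) w2 => // _ /= W.
by rewrite (_ : _ %% 4 = 0) //; lia.
Qed.

(** * From labels and states to a coloring *)

(* The degree in the base color of a vertex of R labeled l whose predecessor is
   labeled a. *)
Definition base_deg (a l : label) : nat := ~~ is_long a + ~~ is_long l + is_bare l.

(** The arc leaving a [Long] vertex shares its color with the matching edge there, giving degree 2,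
    while a [Bare] successor has degree 1 in that color. Every other arc has the base color. *)
Definition label_ok (a l b : label) : bool :=
  if is_long l then is_bare b else base_deg a l != base_deg l b.

Lemma orients_neq (G : sgraph) (s t : G -> G) x : orients s t -> s x != t x.
Proof.
by case=> st ts ssN _; apply: contraNneq (ssN (t x)) => E; rewrite ts -E.
Qed.

Section ColoringFromStates.
Variables (C R : sgraph) (phi : C -> R) (psi : R -> C).
Hypotheses (phiK : cancel phi psi) (psiK : cancel psi phi).
Variables (s t : C -> C) (p q : R -> R).
Hypotheses (st_or : orients s t) (pq_or : orients p q).
Variables (lab : R -> label) (sta : C -> state).
Hypothesis labP : forall r, label_ok (lab (q r)) (lab r) (lab (p r)).
Hypothesis staP : forall u, trans (lab (phi u)) (sta (t u)) (sta u).

Let G := perm_graph phi.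

(** The truth value is itself the matching color: when the transition with [true] fails, [staP]
    provides the one with [false]. *)
Definition match_side (u : C) : bool :=
  trans_with (lab (phi u)) true (sta (t u)) (sta u).

Lemma match_sideP u :
  trans_with (lab (phi u)) (match_side u) (sta (t u)) (sta u).
Proof. by have := staP u; rewrite /trans; case E: match_side => /=; rewrite -/(match_side u) E. Qed.

Definition match_col (r : R) : option bool :=
  if is_bare (lab r) then None else Some (match_side (psi r)).

Definition arc_col (r : R) : option bool :=
  if is_long (lab r) then Some (match_side (psi r)) else None.

(** [None] is the base color. An edge of the cycle or of [R] takes the color stored at its tail. *)
Definition ring_col : G -> G -> option bool := fun x y =>
  match x, y with
  | inl u, inl v => Some (sta (if v == s u then u else v)).1
  | inl u, inr r | inr r, inl u => match_col r
  | inr r, inr r' => if r' == p r then arc_col r else arc_col r'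
  end.

Lemma ring_deg_cycle u i :
  col_deg ring_col (inl u) i =
  (Some (sta (t u)).1 == i) + (Some (sta u).1 == i) + (match_col (phi u) == i).
Proof.
have sNt := orients_neq u st_or; have [st ts ss adjE] := st_or.
rewrite (@col_deg_nbrs _ G _ _ [:: inl (t u); inl (s u); inr (phi u)]).
- by rewrite !big_cons big_nil /= eqxx [t u == _]eq_sym (negPf sNt) addn0 addnA.
- by rewrite /= !inE !(inj_eq (@inl_inj _ _)) [t u == _]eq_sym (negPf sNt).
- move=> [v|r]; rewrite !inE /= ?adjE ?(inj_eq (@inl_inj _ _)) ?(inj_eq (@inr_inj _ _)) ?orbF //.
  by rewrite orbC.
Qed.

Lemma ring_deg_ring r i :
  col_deg ring_col (inr r) i =
  (arc_col (q r) == i) + (arc_col r == i) + (match_col r == i).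
Proof.
have sNt := orients_neq r pq_or; have [st ts ss adjE] := pq_or.
rewrite (@col_deg_nbrs _ G _ _ [:: inr (q r); inr (p r); inl (psi r)]).
- by rewrite !big_cons big_nil /= eqxx [q r == _]eq_sym (negPf sNt) addn0 addnA.
- by rewrite /= !inE !(inj_eq (@inr_inj _ _)) [q r == _]eq_sym (negPf sNt).
- move=> [v|r']; rewrite !inE /= ?adjE ?(inj_eq (@inl_inj _ _)) ?(inj_eq (@inr_inj _ _)) ?orbF.
    by rewrite eq_sym (can2_eq phiK psiK).
  by rewrite orbC.
Qed.

Lemma ring_colP : irr_col ring_col.
Proof.
pose good (x y : G) := ring_col x y = ring_col y x /\
  col_deg ring_col x (ring_col x y) != col_deg ring_col y (ring_col x y).
have goodC x y : good x y -> good y x.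
  by case=> E dN; split=> //; rewrite -E eq_sym.
have goodCC u : good (inl u) (inl (s u)).
  have [st ts ss _] := st_or; split.
    by rewrite /= eqxx [u == _]eq_sym (negPf (ss u)).
  rewrite !ring_deg_cycle /= eqxx st.
  have /and3P[_ /eqP uE _] := match_sideP u; have /and3P[] := match_sideP (s u).
  rewrite st uE /match_col !phiK /vdeg /= => N _ _; move: N.
  case: (lab (phi u)); case: (lab (phi (s u))); case: (match_side u);
  case: (match_side (s u)); case: (sta (t u)).1; case: (sta u).1; by case: (sta (s u)).1.
have goodCR u : good (inl u) (inr (phi u)).
  split=> //; rewrite ring_deg_cycle ring_deg_ring /= /arc_col /match_col !phiK.
  (* A [Long] predecessor forces [phi u] to be [Bare], so the incoming arc adds nothing to a boolean
     matching color. A base-colored matching edge has degree 1 on the cycle and at least 2 in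
     [R]. *)
  have /and3P[_ _] := match_sideP u; have := labP (q (phi u)).
  have [_ qp _ _] := pq_or; rewrite qp /label_ok /vdeg /=.
  case: (lab (phi u)); case: (lab (q (phi u))) => //= _; case: (match_side u);
    case: (sta (t u)).1; case: (sta u).1 => //=; by case: match_side.
have goodRR r : good (inr r) (inr (p r)).
  have [pq qp pp _] := pq_or; split.
    by rewrite /= eqxx [r == _]eq_sym (negPf (pp r)).
  rewrite !ring_deg_ring /= eqxx pq.
  have := labP (q r); have := labP r; have := labP (p r).
  rewrite pq qp /arc_col /match_col /label_ok /base_deg.
  case: (lab r); case: (lab (q r)) => //=; case: (lab (p r)) => //=; case: (lab (p (p r))) => //=;
  case: match_side => //=; case: match_side => //=; by case: match_side.
have [st ts ss adjC] := st_or; have [pq qp pp adjR] := pq_or.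
move=> [u|r] [v|r'] /=; rewrite ?adjC ?adjR.
- case/orP=> /eqP->; first exact: goodCC.
  by apply: (goodC (inl (t u)) (inl u)); have := goodCC (t u); rewrite ts.
- by move/eqP->; apply: goodCR.
- by move/eqP->; exact: (goodC _ _ (goodCR _)).
- case/orP=> /eqP->; first exact: goodRR.
  by apply: (goodC (inr (q r)) (inr r)); have := goodRR (q r); rewrite qp.
Qed.

End ColoringFromStates.

(** * Permutations with a single orbit *)

Definition one_orbit (T : finType) (f : T -> T) : Prop := forall x y, fconnect f x y.

Lemma one_orbit_order (T : finType) (f : T -> T) x : one_orbit f -> order f x = #|T|.
Proof. by move=> cf; rewrite /order; apply: eq_card => y; rewrite !inE; apply: cf. Qed.

Lemma one_orbit_can (T : finType) (f g : T -> T) :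
  cancel f g -> one_orbit f -> one_orbit g.
Proof.
move=> fg cf x y; have /iter_findex <- := cf y x.
elim: findex => [|i IHi] //=; rewrite fconnect_eqVf fg IHi; exact: orbT.
Qed.

Lemma one_orbit_states (T : finType) (s t : T -> T) (lb : T -> label) u :
  cancel s t -> cancel t s -> one_orbit s ->
  closed_walk (fun i => lb (iter i s u)) #|T| ->
  exists sta : T -> state, forall v, trans (lb v) (sta (t v)) (sta v).
Proof.
move=> st ts cs [s0 [q [q0 qn qP]]].
(* The state of [v] is the one reached once its label has been read, hence the shift by one. At the
   start vertex, the equality of [q 0] and [q #|T|] closes the cycle. *)
exists (fun v => q (findex s u v).+1) => v.
have ordT := one_orbit_order u cs.
have := findex_max (cs u v); rewrite ordT; set i := findex s u v => ltin.
have <- : q i = q (findex s u (t v)).+1; last first.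
  by have := qP i ltin; rewrite iter_findex.
have vE : iter i s u = v by apply: iter_findex.
case: {qP} i vE ltin => [<-|i <- lti].
  have -> : t (iter 0 s u) = iter (order s u).-1 s u.
    apply: (can_inj st); rewrite ts -iterS orderSpred iter_order //; exact: can_inj st.
  by rewrite findex_iter orderSpred // ordT qn.
by rewrite iterS st findex_iter // ordT ltnW.
Qed.

Lemma one_orbit_sum (T : finType) (s : T -> T) (F : T -> nat) u : one_orbit s ->
  \sum_(0 <= i < #|T|) F (iter i s u) = \sum_v F v.
Proof.
move=> cs; rewrite [RHS](_ : _ = \sum_(v <- orbit s u) F v); last first.
  rewrite (big_uniq _ (orbit_uniq s u)) /=; apply: eq_bigl => v.
  by rewrite -fconnect_orbit cs.
rewrite (big_nth u) size_orbit -(one_orbit_order u cs).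
by apply: eq_big_nat => i /andP[_ lti]; rewrite nth_traject.
Qed.

Lemma order_fconnect (T : finType) (f : T -> T) x y :
  injective f -> fconnect f x y -> order f x = order f y.
Proof.
move=> finj xy; apply: eq_card => z.
exact: (same_connect (fconnect_sym finj) xy).
Qed.

(** * Labels on the cycles of R *)

(* Short, Bare alternate on even cycles; odd cycles read
   Short, Bare, ..., Short, Bare, Long, Bare, Bare. *)
Definition ring_label (l i : nat) : label :=
  if odd l && (i == l - 3) then Long
  else if odd i || (odd l && (i == l.-1)) then Bare else Short.

Lemma ring_label_even l i :
  ~~ odd l -> ring_label l i = if odd i then Bare else Short.
Proof. by rewrite /ring_label => /negPf->; rewrite orbF. Qed.

Lemma ring_label_odd m i : ~~ odd m -> i < m.+3 ->
  ring_label m.+3 i = if i < m then if odd i then Bare else Short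
                      else if i == m then Long else Bare.
Proof.
rewrite /ring_label /= => m_even; rewrite m_even /= subSS subSS subSS subn0 ltnS.
have [lt_im _|lt_mi le_im|//] := ltngtP i m; first by rewrite ltn_eqF ?orbF //; lia.
have [->|im] := eqVneq i m.+2; first by rewrite orbT.
by have -> : i = m.+1 by [lia]; rewrite /= m_even.
Qed.

(** The base degrees read 2, 3, ..., 2, 3 on an even cycle and 2, 3, ..., 2, 3, 1, 2, 3 on an odd
    one, where the 1 belongs to the [Long] vertex. *)
Lemma ring_label_ok l i : 3 <= l -> i < l ->
  label_ok (ring_label l (if i == 0 then l.-1 else i.-1)) (ring_label l i)
           (ring_label l (if i.+1 == l then 0 else i.+1)).
Proof.
move=> l3 il; have [l_odd|l_even] := boolP (odd l); last first.
  rewrite !ring_label_even //.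
  have -> : odd (if i == 0 then l.-1 else i.-1) = ~~ odd i.
    by case: eqP => ?; lia.
  have -> : odd (if i.+1 == l then 0 else i.+1) = ~~ odd i.
    by case: eqP => ?; lia.
  by case: (odd i).
have [m m_even lE] : exists2 m, ~~ odd m & l = m.+3 by exists (l - 3); lia.
rewrite {l l3 l_odd}lE in il *; rewrite !eqSS /=.
have Lm : ring_label m.+3 m = Long.
  by rewrite ring_label_odd //; [rewrite ltnn eqxx|lia].
have Lm1 : ring_label m.+3 m.+1 = Bare.
  by rewrite ring_label_odd //; case: ltngtP => //; lia.
have Lm2 : ring_label m.+3 m.+2 = Bare.
  by rewrite ring_label_odd //; case: ltngtP => //; lia.
have Lt j : j < m -> ring_label m.+3 j = if odd j then Bare else Short.
  by move=> lt_jm; rewrite ring_label_odd ?lt_jm //; lia.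
have [->|im] := eqVneq i m.+2.
  rewrite /= Lm1 Lm2; case: (posnP m) => [m0|/Lt-> //].
  by have := Lm; rewrite {2}m0 => ->.
have [->|im1] := eqVneq i m.+1; first by rewrite /= Lm Lm1 Lm2.
have [->|im2] := eqVneq i m; first by rewrite Lm Lm1.
have lt_im : i < m by lia.
rewrite (Lt i) //; have [->|i_gt0] := posnP i.
  by rewrite Lm2 (Lt 1) //; lia.
rewrite (Lt i.-1); last by lia.
have -> : odd i.-1 = ~~ odd i by lia.
have [eq_im|lt1] := eqVneq i.+1 m.
  by rewrite eq_im Lm; have -> : odd i by lia.
by rewrite Lt /=; [case: (odd i)|lia].
Qed.

Section Labels.
Variables (R : sgraph) (p q : R -> R).
Hypothesis pq_or : orients p q.

Let pinj : injective p. Proof. by case: pq_or => /can_inj. Qed.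

Lemma orients_order_ge3 r : 3 <= order p r.
Proof.
have := iter_order pinj r; have := order_gt0 p r.
case: order => [|[|[|l]]] //= _ E.
  have [_ _ _ adjE] := pq_or; have := adj_irrefl r.
  by rewrite adjE E eqxx.
by have [_ _ /(_ r)] := pq_or; rewrite E eqxx.
Qed.

(* The first element of xs on the cycle of r is where the labels of this cycle
   start. *)
Definition pick_root (xs : seq R) (r : R) : R :=
  head (froot p r) [seq x <- xs | fconnect p x r].

Lemma pick_root_connect xs r : fconnect p (pick_root xs r) r.
Proof.
rewrite /pick_root; case E: [seq x <- xs | fconnect p x r] => [|x ys] /=.
  by rewrite fconnect_sym // connect_root.
have : x \in [seq x <- xs | fconnect p x r] by rewrite E mem_head.
by rewrite mem_filter => /andP[].
Qed.

Lemma pick_root_next xs r : pick_root xs (p r) = pick_root xs r.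
Proof.
rewrite /pick_root (@eq_filter _ _ (fun x => fconnect p x r)); last first.
  by move=> x; rewrite -same_fconnect1_r.
congr head; apply/eqP; rewrite root_connect; last exact: fconnect_sym.
by rewrite fconnect_sym // fconnect1.
Qed.

Definition ring_index xs r : nat := findex p (pick_root xs r) r.

Lemma ring_index_lt xs r : ring_index xs r < order p r.
Proof.
rewrite -(order_fconnect pinj (pick_root_connect xs r)).
exact/findex_max/pick_root_connect.
Qed.

Lemma ring_index_next xs r :
  ring_index xs (p r) =
  if (ring_index xs r).+1 == order p r then 0 else (ring_index xs r).+1.
Proof.
have cr := pick_root_connect xs r; have lt := ring_index_lt xs r.
have pE : p r = iter (ring_index xs r).+1 p (pick_root xs r).
  by rewrite iterS iter_findex.
rewrite [LHS]/ring_index pick_root_next pE; case: eqP => [->|N].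
  by rewrite -(order_fconnect pinj cr) iter_order // findex0.
by rewrite findex_iter // (order_fconnect pinj cr); lia.
Qed.

Definition labeling xs r : label := ring_label (order p r) (ring_index xs r).

Lemma labelingP xs r :
  label_ok (labeling xs (q r)) (labeling xs r) (labeling xs (p r)).
Proof.
have [pq qp _ _] := pq_or.
have ordE z : order p (p z) = order p z.
  by apply/esym/order_fconnect => //; apply: fconnect1.
have ordq : order p (q r) = order p r by rewrite -{2}(qp r) ordE.
have := ring_label_ok (orients_order_ge3 r) (ring_index_lt xs r).
rewrite /labeling ordE ordq -ring_index_next.
have := ring_index_next xs (q r); have := ring_index_lt xs (q r).
by rewrite qp ordq; case: eqP => [<- _ ->|_ _ ->].
Qed.

End Labels.

(** * Closing the walk: a cycle of length at least 4 in R, or triangles only *)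

Section Cases.
Variables (C R : sgraph) (phi : C -> R) (psi : R -> C).
Hypotheses (phiK : cancel phi psi) (psiK : cancel psi phi).
Variables (p q : R -> R).
Hypothesis pq_or : orients p q.

Let pinj : injective p. Proof. by case: pq_or => /can_inj. Qed.

Definition colored : Prop :=
  exists col : perm_graph phi -> perm_graph phi -> option bool, irr_col col.

Lemma colored_walk (s t : C -> C) xs u : orients s t -> one_orbit s ->
  closed_walk (fun i => labeling p xs (phi (iter i s u))) #|C| -> colored.
Proof.
move=> st_or cs cw; have [st ts _ _] := st_or.
have [sta staP] := one_orbit_states (lb := fun v => labeling p xs (phi v)) st ts cs cw.
apply: ex_intro.
exact: (ring_colP phiK psiK st_or pq_or (labelingP pq_or xs) staP).
Qed.

Lemma labeling_head r xs : 4 <= order p r -> is_short (labeling p (r :: xs) r).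
Proof.
move=> l4; rewrite /labeling /ring_index /pick_root /= connect0 /= findex0.
by rewrite /ring_label; do ![case: ifP => //=]; lia.
Qed.

Lemma colored_long_step (s t : C -> C) r : orients s t -> one_orbit s ->
  4 <= order p r ->
  ~~ (fconnect p r (phi (s (psi r))) &&
      (findex p r (phi (s (psi r))) == order p r - 3)) -> colored.
Proof.
move=> st_or cs l4; set v := phi (s (psi r)) => vN.
have [pq qp _ _] := pq_or; have [st _ _ _] := st_or.
(* On the cycle of [r] the hypothesis excludes the [Long] index. Any other cycle is rooted at [q v],
   which puts [v] at index 1; a [Long] there would need length 4, which is even. *)
have vnl : ~~ is_long (labeling p [:: r; q v] v).
  rewrite /labeling /ring_index /pick_root /=.
  case rv: (fconnect p r v) vN => /=.
    rewrite (order_fconnect pinj rv) => idx; rewrite /ring_label (negPf idx) andbF.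
    by case: ifP.
  have qv : fconnect p (q v) v by rewrite -{2}(qp v) fconnect1.
  have l3 := orients_order_ge3 pq_or v.
  have fE : findex p (q v) v = 1.
    rewrite -{2}(qp v) -[p (q v)]/(iter 1 p (q v)) findex_iter //.
    by rewrite (order_fconnect pinj qv); lia.
  rewrite qv /= fE => _.
  by rewrite /ring_label; do ![case: ifP => //=]; lia.
have [m mE] : exists m, #|C| = m.+2.
  exists (#|C| - 2); have := leq_trans l4 (max_card _); have := bij_eq_card (Bijective phiK psiK).
  lia.
(* With this start the last two labels read are those of [r], which is [Short], and of [v]. *)
apply: (@colored_walk s t [:: r; q v] (s (s (psi r)))) => //.
have itE : iter m s (s (s (psi r))) = psi r.
  rewrite -!iterSr -mE -(one_orbit_order (psi r) cs) iter_order //; exact: can_inj st.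
by rewrite mE; apply: closed_walk_short; rewrite ?iterS itE ?psiK // labeling_head.
Qed.

(** If the step fails in both directions along the cycle, both neighbors of [psi r] are matched to
    the same vertex, the unique one at index [order p r - 3] from [r]. *)
Lemma colored_long (s t : C -> C) r :
  orients s t -> one_orbit s -> 4 <= order p r -> colored.
Proof.
move=> st_or cs l4; have [st ts ss adjE] := st_or.
have ts_or : orients t s.
  split=> // [x|x y]; last by rewrite adjE orbC.
  by apply: contraNneq (ss x) => E; rewrite -{1}E !ts.
have ct := one_orbit_can st cs.
have [/andP[sc /eqP si]|] := boolP (fconnect p r (phi (s (psi r))) &&
      (findex p r (phi (s (psi r))) == order p r - 3)); last exact: (colored_long_step st_or cs l4).
apply: (colored_long_step (r := r) ts_or ct) => //; apply/negP => /andP[tc /eqP ti].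
have /eqP := orients_neq (psi r) st_or; apply.
by apply: (can_inj phiK); rewrite -(iter_findex sc) -(iter_findex tc) si ti.
Qed.

Section Triangles.
Hypothesis p3 : forall r, order p r = 3.

Lemma triangle_next3 r : p (p (p r)) = r.
Proof. by have := iter_order pinj r; rewrite p3. Qed.

Lemma labeling3 xs r : labeling p xs r = if r == pick_root p xs r then Long else Bare.
Proof.
rewrite /labeling p3 /ring_index [r == _]eq_sym -(findex_eq0 p) -/(ring_index p xs r).
by have := ring_index_lt pq_or xs r; rewrite p3; case: ring_index => [|[|[|]]].
Qed.

(** A triangle has labels [Long], [Bare], [Bare] of weight 2. Summing over the three rotations by
    [p] replaces a sum over triangles. *)
Lemma triangle_total_weight (s : C -> C) xs u : one_orbit s ->
  3 * total_weight (fun i => labeling p xs (phi (iter i s u))) 0 #|C| = 2 * #|C|.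
Proof.
move=> cs; pose F r := weight (labeling p xs r).
rewrite /total_weight (one_orbit_sum (fun v => F (phi v)) u cs).
have -> : \sum_v F (phi v) = \sum_r F r.
  by rewrite [RHS](reindex phi) //; apply: onW_bij; exists psi.
have e1 : \sum_r F (p r) = \sum_r F r by rewrite [RHS](reindex_inj pinj).
have e2 : \sum_r F (p (p r)) = \sum_r F r by rewrite -e1 [RHS](reindex_inj pinj).
have -> : 3 * \sum_r F r = \sum_r (F r + F (p r) + F (p (p r))).
  by rewrite !big_split /= e1 e2; lia.
rewrite (bij_eq_card (Bijective phiK psiK)) mulnC -sum_nat_const.
apply: eq_bigr => r _; rewrite /F !labeling3 !(pick_root_next pq_or).
have [_ _ /(_ r) ppN adjE] := pq_or.
have pN : p r != r by apply/eqP => E; have := adj_irrefl r; rewrite adjE E eqxx.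
have pppN : p (p r) != p r by rewrite (inj_eq pinj).
have /iter_findex := pick_root_connect pq_or xs r.
have := findex_max (pick_root_connect pq_or xs r); rewrite p3.
set x := pick_root p xs r; case: findex => [|[|[|]]] //= _ E.
- by rewrite E eqxx (negPf ppN) (negPf pN).
- have -> : x = p (p r) by rewrite -E triangle_next3.
  by rewrite eqxx ![_ == p (p r)]eq_sym (negPf ppN) (negPf pppN).
- have -> : x = p r by rewrite -E triangle_next3.
  by rewrite eqxx (negPf pppN) [r == _]eq_sym (negPf pN).
Qed.

(** An even number of vertices is here a multiple of 6, so the total weight is a multiple of 4. The
    walk starts just after a vertex that is not [Long]. *)
Lemma colored_even (s t : C -> C) : orients s t -> one_orbit s ->
  0 < #|C| -> ~~ odd #|C| -> colored.
Proof.
move=> st_or cs /card_gt0P[u0 _] evC; have [st ts _ _] := st_or.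
have [r0 r0N] : exists r, ~~ is_long (labeling p [::] r).
  have := labelingP pq_or [::] (phi u0); rewrite /label_ok.
  case: ifPn => [_|r0N _]; last by exists (phi u0).
  by move=> b; exists (p (phi u0)); case: labeling b.
have [m mE] : exists m, #|C| = m.+1.
  by exists #|C|.-1; rewrite prednK //; apply/card_gt0P; exists u0.
apply: (@colored_walk s t [::] (s (psi r0))) => //.
have := triangle_total_weight [::] (s (psi r0)) cs; rewrite mE => W.
apply: closed_walk_weight0; last by move: W evC; rewrite mE; lia.
rewrite -iterSr -mE -(one_orbit_order (psi r0) cs) iter_order ?psiK //.
exact: can_inj st.
Qed.

Lemma colored_odd (s t : C -> C) : orients s t -> one_orbit s ->
  3 < #|C| -> odd #|C| -> colored.
Proof.
move=> st_or cs C4 oddC; have [st ts ss adjC] := st_or; have [pq qp pp adjR] := pq_or.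
have sinj := can_inj st; have phinj := can_inj phiK.
have iterC u : iter #|C| s u = u by rewrite -(one_orbit_order u cs) iter_order.
have [u0 _] : exists u0 : C, u0 \in C by apply/card_gt0P; apply: leq_trans C4.
(* Otherwise, the length being odd, double steps reach the whole cycle and [R] is a single triangle,
   against [3 < #|C|]. *)
have [u uN] : exists u, ~~ fconnect p (phi u) (phi (s (s u))).
  apply/existsP; rewrite -[X in is_true X]negbK negb_exists; apply/negP => /forallP con.
  have con2 k u : fconnect p (phi u) (phi (iter k.*2 s u)).
    elim: k => [|k IHk]; first exact: connect0.
    by apply: connect_trans IHk _; have := con (iter k.*2 s u); rewrite negbK.
  have con1 u : fconnect p (phi u) (phi (s u)).
    have eC : #|C|./2.+1.*2 = #|C|.+1 by lia.
    by have := con2 #|C|./2.+1 u; rewrite eC iterS iterC.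
  have conA v : fconnect p (phi u0) (phi v).
    rewrite -(iter_findex (cs u0 v)); elim: findex => [|k IHk]; first exact: connect0.
    exact: connect_trans IHk (con1 _).
  have := p3 (phi u0); rewrite /order (@eq_card _ _ R); last first.
    by move=> r; rewrite !inE -[r]psiK conA.
  by rewrite -(bij_eq_card (Bijective phiK psiK)); move: C4; case: #|C| => [|[|[|[|]]]].
(* The roots make [phi u] and [phi (s (s u))] [Long]. The vertex [x] lies on the triangle of [a] and
   differs from [a] and [b]; with [p b] as a last resort, neither [a] nor [b] becomes a root. *)
pose a := phi (t u); pose b := phi (s u).
pose x := if p a == b then p (p a) else p a.
pose xs := [:: phi u; phi (s (s u)); x; p b].
have [m mE] : exists m, #|C| = m.+1 by exists #|C|.-1; lia.
have pNid r : p r != r by apply/eqP => E; have := adj_irrefl r; rewrite adjR E eqxx.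
have sNid v : s v != v by apply/eqP => E; have := adj_irrefl v; rewrite adjC E eqxx.
have tE : t u = iter m s u by apply: sinj; rewrite ts -iterS -mE iterC.
have xa : fconnect p x a.
  rewrite fconnect_sym // /x; case: ifP => _; rewrite ?fconnect1 //.
  exact: (fconnect_iter p 2 a).
have xNa : x != a by rewrite /x; case: ifP => _; rewrite ?pp ?pNid.
have xNb : x != b by rewrite /x; case: ifPn => // /eqP<-; rewrite (inj_eq pinj) pNid.
have tN : u != t u by rewrite -(inj_eq sinj) ts sNid.
have ssN : s (s u) != t u.
  rewrite -(inj_eq sinj) ts; apply/eqP => E.
  have := iterC u; move: C4; have := @findex_iter _ s u 3.
  rewrite one_orbit_order //= E findex0 => abs C4 _; by have := abs C4.
have Lu : is_long (labeling p xs (phi u)).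
  by rewrite labeling3 /pick_root /= connect0 /= eqxx.
have Lssu : is_long (labeling p xs (phi (s (s u)))).
  by rewrite labeling3 /pick_root /= (negPf uN) connect0 /= eqxx.
have Bsu : is_bare (labeling p xs (phi (s u))).
  suff N : b != pick_root p xs b by rewrite labeling3 -/b (negPf N).
  rewrite /pick_root /=; case: ifP => _ /=.
    by rewrite (inj_eq phinj) sNid.
  case: ifP => _ /=; first by rewrite (inj_eq phinj) eq_sym sNid.
  case: ifP => _ /=; first by rewrite eq_sym.
  by rewrite fconnect_sym // fconnect1 /= eq_sym pNid.
have Btu : ~~ is_long (labeling p xs (phi (t u))).
  suff N : a != pick_root p xs a by rewrite labeling3 -/a (negPf N).
  rewrite /pick_root /= xa; case: ifP => _ /=.
    by rewrite (inj_eq phinj) eq_sym.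
  case: ifP => _ /=; first by rewrite (inj_eq phinj) eq_sym.
  by rewrite eq_sym.
apply: (@colored_walk s t xs u) => //.
have := triangle_total_weight xs u cs; rewrite mE => W.
by apply: closed_walk_weight2; rewrite -?tE //; move: W C4 oddC; rewrite mE; lia.
Qed.

End Triangles.

End Cases.

(** * Circulants, the prism and the conclusion *)

Lemma modn_lt_double m n : m < n + n -> m %% n = if m < n then m else m - n.
Proof.
move=> lt; case: ltnP => [/modn_small//|le].
by rewrite -{1}(subnK le) modnDr modn_small //; lia.
Qed.

Lemma circ_orients n k (adjk := SGraph (@circ_adj_sym n k) (@circ_adj_irrefl n k))
    (k_gt0 : 0 < k) (k_lt : k * 2 < n) :
  exists s t : adjk -> adjk, orients s t /\ forall i : 'I_n, s i = (i + k) %% n :> nat.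
Proof.
have n_gt0 : 0 < n by lia.
exists (fun i : 'I_n => Ordinal (ltn_pmod (i + k) n_gt0)).
exists (fun i : 'I_n => Ordinal (ltn_pmod (i + (n - k)) n_gt0)).
split=> //; split.
- move=> i; apply: val_inj; rewrite /= modnDml -addnA subnKC ?modnDr ?modn_small //; lia.
- move=> i; apply: val_inj; rewrite /= modnDml -addnA subnK ?modnDr ?modn_small //; lia.
- move=> i; rewrite -val_eqE /= modnDml; have := ltn_ord i => ?.
  by rewrite modn_lt_double; last lia; case: ltnP; lia.
- move=> i j; rewrite /= /circ_adj -!val_eqE /=; have := ltn_ord i; have := ltn_ord j => ? ?.
  by rewrite !modn_lt_double; try lia; do 3 case: ltnP => ?; lia.
Qed.

Lemma orients_regular2 (G : sgraph) (s t : G -> G) : orients s t -> regular G 2.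
Proof.
move=> st_or x; have [_ _ _ adjE] := st_or.
rewrite /degree (_ : [set y | adj x y] = [set s x; t x]).
  by rewrite cards2 orients_neq.
by apply/setP => y; rewrite !inE adjE.
Qed.

Lemma cycle_orients n : 3 <= n ->
  exists s t : cycle_graph n -> cycle_graph n, orients s t /\ one_orbit s.
Proof.
move=> n3; have [//||s [t [st_or sE]]] := @circ_orients n 1; first by lia.
exists s, t; split=> // i j.
suff <- : iter (j + (n - i)) s i = j by apply: fconnect_iter.
have itE k : iter k s i = (i + k) %% n :> nat.
  elim: k => [|k IHk]; first by rewrite addn0 modn_small.
  by rewrite iterS sE IHk modnDml; congr (_ %% _); lia.
apply: val_inj; rewrite /= itE; have := ltn_ord i; have := ltn_ord j => ? ?.
have -> : i + (j + (n - i)) = j + n by lia.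
by rewrite modnDr modn_small.
Qed.

Lemma orients_iso (G H : sgraph) (f : G -> H) (s t : H -> H) : bijective f ->
  (forall x y, adj (f x) (f y) = adj x y) -> orients s t -> one_orbit s ->
  exists s' t' : G -> G, orients s' t' /\ one_orbit s'.
Proof.
case=> g fK gK fadj [st ts ss adjE] cs.
exists (fun x => g (s (f x))), (fun x => g (t (f x))); split; first split.
- by move=> x; rewrite gK st.
- by move=> x; rewrite gK ts.
- by move=> x; rewrite gK (can2_eq gK fK).
- by move=> x y; rewrite -fadj adjE -!(can2_eq fK gK).
move=> x y; rewrite -(fK y) -(iter_findex (cs (f x) (f y))).
rewrite (_ : g _ = iter (findex s (f x) (f y)) (fun x => g (s (f x))) x) ?fconnect_iter //.
by elim: findex => [|k IHk] /=; [rewrite fK|rewrite -IHk gK].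
Qed.

Lemma card3_complete (G : sgraph) : #|G| = 3 -> regular G 2 ->
  forall x y : G, adj x y = (x != y).
Proof.
move=> G3 G2 x y.
have sub : [set z | adj x z] \subset [set~ x].
  by apply/subsetP => z; rewrite !inE; apply: contraTneq => ->; rewrite adj_irrefl.
have /eqP E : [set z | adj x z] == [set~ x].
  by rewrite eqEcard sub cardsC1 G3; have := G2 x; rewrite /degree => ->.
by have := in_setC1 y x; rewrite eq_sym -E inE.
Qed.

Definition prism : sgraph := generalized_petersen 3 1.

(** The boolean classes are paths with two edges, centered at [inl 0] and [inr 2]. The base class is
    a tree with center [inl 1] and legs of lengths 1, 2, 2. *)
Definition prism_col (x y : prism) : option bool :=
  match x, y with
  | inl i, inl j => if i + j == 2 then Some true else None
  | inr i, inr j => if i + j == 1 then None else Some false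
  | inl i, inr j | inr i, inl j => if i == 0 :> nat then Some true else None
  end.

Lemma prism_colP : irr_col prism_col.
Proof.
have degE x i : col_deg prism_col x i = \sum_z (adj x z && (prism_col x z == i)).
  by rewrite /col_deg -sum1_card big_mkcond; apply: eq_bigr => z _; rewrite inE; case: ifP.
have cirE (i j : 'I_3) : circ_adj 1 i j = (i != j :> nat).
  by case: i j => [[|[|[|//]]] ?] [[|[|[|//]]] ?].
move=> x y; rewrite !degE !big_sumType !big_ord_recl !big_ord0.
case: x y => [[[|[|[|//]]] ?]|[[|[|[|//]]] ?]] [[[|[|[|//]]] ?]|[[|[|[|//]]] ?]];
  rewrite /= ?cirE //=.
Qed.

(** Since [R] is complete on three vertices, every bijection [phi] yields the prism: [r] is sent to
    the copy of [f (psi r)]. *)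
Lemma prism_colored (C R : sgraph) (phi : C -> R) (f : C -> cycle_graph 3) :
  bijective f -> (forall x y, adj (f x) (f y) = adj x y) ->
  bijective phi -> #|R| = 3 -> regular R 2 -> colored phi.
Proof.
move=> [g fK gK] fadj [psi phiK psiK] R3 R2.
pose h (x : perm_graph phi) : prism :=
  match x with inl u => inl (f u) | inr r => inr (f (psi r)) end.
pose h' (x : prism) : perm_graph phi :=
  match x with inl i => inl (g i) | inr i => inr (phi (g i)) end.
exists (fun x y => prism_col (h x) (h y)); apply: irr_col_iso prism_colP.
  by exists h' => [[u|r]|[i|i]] /=; rewrite ?fK ?gK ?phiK ?psiK ?gK.
have cadj (i j : 'I_3) : circ_adj 1 i j = (i != j).
  by case: i j => [[|[|[|//]]] ?] [[|[|[|//]]] ?].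
move=> [u|r] [v|r'] //=; first exact: fadj.
- by rewrite (can_eq fK) eq_sym (can2_eq psiK phiK).
- by rewrite (can_eq fK) (can2_eq psiK phiK).
- by rewrite cadj (can_eq fK) (can_eq psiK) card3_complete.
Qed.

Lemma ring_permutation_colored n (C R : sgraph) (phi : C -> R) : 3 <= n ->
  graph_iso C (cycle_graph n) -> #|R| = n -> regular R 2 -> bijective phi ->
  colored phi.
Proof.
move=> n3 [f [fbij fadj]] Rn R2 phibij; have [psi phiK psiK] := phibij.
have [s0 [t0 [st0 cs0]]] := cycle_orients n3.
have [s [t [st_or cs]]] := orients_iso fbij fadj st0 cs0.
have [p [q pq_or]] := regular2_orients R2.
have Cn : #|C| = n by rewrite (bij_eq_card phibij).
have [/existsP[r r4]|] := boolP [exists r, 4 <= order p r].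
  exact: (colored_long phiK psiK pq_or st_or cs r4).
rewrite negb_exists => /forallP p3.
have {}p3 r : order p r = 3.
  by have := p3 r; have := orients_order_ge3 pq_or r; lia.
have [oC|eC] := boolP (odd #|C|); last first.
  by apply: (colored_even phiK psiK pq_or p3 st_or cs) => //; lia.
have [C4|C3] := ltnP 3 #|C|.
  exact: (colored_odd phiK psiK pq_or p3 st_or cs).
have nE : n = 3 by lia.
by move: f fbij fadj Rn; rewrite nE => f fbij fadj R3; exact: (prism_colored fbij fadj).
Qed.

Lemma colored_chi_irr (G : sgraph) (col : G -> G -> option bool) :
  irr_col col -> exists dG : irr_decomposable G, chi_irr dG <= 3.
Proof.
move=> /irr_colorable_col; rewrite card_option card_bool; exact: chi_irr_leq.
Qed.

Theorem theorem4 (n : nat) (n_ge3 : 3 <= n) :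
  [/\ (forall (C R : sgraph) (phi : C -> R),
         graph_iso C (cycle_graph n) -> #|R| = n -> regular R 2 ->
         bijective phi ->
         exists dG : irr_decomposable (perm_graph phi), chi_irr dG <= 3),
      (forall (C R : sgraph) (phi : C -> R),
         graph_iso C (cycle_graph n) -> graph_iso R (cycle_graph n) ->
         bijective phi ->
         exists dG : irr_decomposable (perm_graph phi), chi_irr dG <= 3)
    & (forall k : nat, 1 <= k -> k * 2 < n ->
         exists dG : irr_decomposable (generalized_petersen n k),
           chi_irr dG <= 3)].
Proof.
split.
- move=> C R phi isoC Rn R2 phibij.
  by have [col /colored_chi_irr] := ring_permutation_colored n_ge3 isoC Rn R2 phibij.
- move=> C R phi isoC [f [fbij fadj]] phibij.
  have [s0 [t0 [st0 cs0]]] := cycle_orients n_ge3.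
  have [s [t [st_or _]]] := orients_iso fbij fadj st0 cs0.
  have Rn : #|R| = n by rewrite (bij_eq_card fbij) card_ord.
  have [col /colored_chi_irr//] :=
    ring_permutation_colored n_ge3 isoC Rn (orients_regular2 st_or) phibij.
(* The inner vertices form the circulant of step [k], possibly several cycles, and the matching is
   the identity on indices. *)
- move=> k k1 kn; have [s [t [st_or _]]] := circ_orients k1 kn.
  set H := SGraph _ _ in s t st_or.
  pose phi (i : cycle_graph n) : H := i.
  have isoC : graph_iso (cycle_graph n) (cycle_graph n).
    by exists id; split=> //; exists id.
  have Hn : #|H| = n by rewrite card_ord.
  have phibij : bijective phi by exists id.
  have [col colP] :=
    ring_permutation_colored n_ge3 isoC Hn (orients_regular2 st_or) phibij.
  pose h (x : generalized_petersen n k) : perm_graph phi :=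
    match x with inl i => inl i | inr i => inr i end.
  have hbij : bijective h.
    by exists (fun x => match x with inl i => inl i | inr i => inr i end) => -[].
  have hadj x y : adj (h x) (h y) = adj x y.
    by case: x y => [i|i] [j|j] //=; rewrite eq_sym.
  exact: colored_chi_irr (irr_col_iso hbij hadj colP).
Qed.
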